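(* For all constants $c>0$ and $d>1$ there exists $\kappa_0=\kappa_0(c,d)>0$ such that the following holds for every $\rho\in\mathbb{R}\setminus\mathbb{Q}$ satisfying the Diophantine condition $\mathrm{dist}(n\rho,\mathbb{Z})\geq c\,n^{-d}$ for all integers $n\geq 1$, and for every $\kappa\geq\kappa_0$. Let $\varphi^+$ be the upper bounding graph of the map $F_\kappa(\theta,x)=(\theta+\rho \bmod 1,\ \tanh(\kappa x)\cdot\sin(\pi\theta))$ on $\mathbb{T}^1\times[0,1]$ and $\mu_{\varphi^+}$ the associated invariant measure. Then for $\mu_{\varphi^+}$-almost every $(\theta,x)\in\mathbb{T}^1\times[0,1]$ the pointwise dimension exists and $$d_{\mu_{\varphi^+}}(\theta,x)=\lim_{\varepsilon\to0}\frac{\log\mu_{\varphi^+}(B_\varepsilon(\theta,x))}{\log\varepsilon}=1.$$ In particular, $\mu_{\varphi^+}$ is exact dimensional.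
   Context: $\mathbb{T}^1=\mathbb{R}/\mathbb{Z}$ with its usual metric, and in $\sin(\pi\theta)$ the point $\theta\in\mathbb{T}^1$ is represented in $[0,1)$. The space $\mathbb{T}^1\times[0,1]$ carries the usual product metric and $B_\varepsilon(\theta,x)$ is the open ball of radius $\varepsilon$. The global attractor is $\mathcal{A}=\bigcap_{n\in\mathbb{N}}F_\kappa^n(\mathbb{T}^1\times[0,1])$. The upper bounding graph is $\varphi^+:\mathbb{T}^1\to[0,1]$, $\varphi^+(\theta)=\sup\{x\in[0,1]\mid(\theta,x)\in\mathcal{A}\}$, with point set $\Phi^+=\{(\theta,\varphi^+(\theta))\mid\theta\in\mathbb{T}^1\}$. The measure $\mu_{\varphi^+}$ is defined by $\mu_{\varphi^+}(A)=\mathrm{Leb}_{\mathbb{T}^1}(\pi_1(A\cap\Phi^+))$ for Borel sets $A\subseteq\mathbb{T}^1\times[0,1]$, where $\pi_1$ is the projection to the first coordinate. A finite Borel measure $\mu$ is exact dimensional if its pointwise dimension $\lim_{\varepsilon\to0}\log\mu(B_\varepsilon(x))/\log\varepsilon$ exists and is constant $\mu$-almost everywhere. *)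

(* Defs.v *)
From HB Require Import structures.
From mathcomp Require Import all_boot all_order all_algebra.
From mathcomp Require Import all_classical all_reals all_analysis.
From mathcomp Require Import measurable_realfun ring lra.

Set Implicit Arguments.
Unset Strict Implicit.
Unset Printing Implicit Defensive.

Import Order.TTheory GRing.Theory Num.Theory.
Import numFieldNormedType.Exports.

Local Open Scope classical_set_scope.
Local Open Scope ring_scope.

Section definitions.
Context {R : realType}.
Implicit Types (rho kappa c d : R) (p q : R * R).

Definition dist_int (y : R) : R := inf [set `|y - k%:~R| | k in [set: int]].

Definition diophantine c d rho : Prop :=
  forall n : nat, (1 <= n)%N -> c * n%:R `^ (- d) <= dist_int (n%:R * rho).

(* The circle R/Z is represented by its fundamental domain [0, 1); its Borel
   sets are then the Borel subsets of [0, 1), while its metric is not that of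
   the real line. *)
Definition circle : set R := `[0, 1[.

Definition circle_dist (s t : R) : R := dist_int (s - t).

Definition cylinder : set (R * R) := circle `*` `[0, 1].

(* Product metric: maximum of the two distances. *)
Definition cyl_ball p (e : R) : set (R * R) :=
  [set q | [/\ cylinder q, circle_dist p.1 q.1 < e & `|p.2 - q.2| < e]].

Definition frac (x : R) : R := x - (Num.floor x)%:~R.

Definition tanh (x : R) : R := (expR x - expR (- x)) / (expR x + expR (- x)).

Definition skew rho kappa p : R * R :=
  (frac (p.1 + rho), tanh (kappa * p.2) * sin (pi * p.1)).

Definition attractor rho kappa : set (R * R) :=
  \bigcap_(n in [set: nat]) (iter n (skew rho kappa) @` cylinder).

Definition upper_graph rho kappa (theta : R) : R :=
  sup [set x | x \in `[0, 1] /\ attractor rho kappa (theta, x)].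

Definition graph_set rho kappa : set (R * R) :=
  [set (theta, upper_graph rho kappa theta) | theta in circle].

Definition mu_graph rho kappa (A : set (R * R)) : \bar R :=
  lebesgue_measure (fst @` (A `&` graph_set rho kappa)).

(* Extended logarithm, so that a ball of measure 0 contributes log 0 = -oo. *)
Definition pointwise_dim (mu : set (R * R) -> \bar R) p (a : \bar R) : Prop :=
  (lne (mu (cyl_ball p e)) / (ln e)%:E)%E @[e --> 0^'+] --> a.

Definition exact_dimensional (mu : {finite_measure set (R * R)%type -> \bar R})
    : Prop :=
  exists a : R, {ae mu, forall p, cylinder p -> pointwise_dim mu p a%:E}.

End definitions.

(* mu_graph rho kappa is a finite Borel measure: the fibre over theta of the
   n-th image of the cylinder is the segment between 0 and
   bounding_line rho kappa n theta, hence upper_graph is Borel measurable. *)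
Section mu_graph_measure.
Context {R : realType}.
Variables rho kappa : R.
Implicit Types (a x y z theta : R).

Let seg a : set R := [set x | 0 <= x <= a \/ a <= x <= 0].

Lemma tanh0 : tanh (0 : R) = 0.
Proof. by rewrite /tanh oppr0 subrr mul0r. Qed.

Lemma tanh_le x y : x <= y -> tanh x <= tanh y.
Proof.
move=> xy; rewrite /tanh.
have x0 := expR_gt0 x; have x1 := expR_gt0 (- x).
have y0 := expR_gt0 y; have y1 := expR_gt0 (- y).
rewrite ler_pdivrMr ?addr_gt0// mulrAC ler_pdivlMr ?addr_gt0//.
have h1 : expR x * expR (- y) <= expR y * expR (- x).
  by rewrite -!expRD ler_expR lerD// lerN2.
rewrite -subr_ge0.
have -> : (expR y - expR (- y)) * (expR x + expR (- x)) -
          (expR x - expR (- x)) * (expR y + expR (- y)) =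
          (expR y * expR (- x) - expR x * expR (- y)) *+ 2 by ring.
by rewrite mulrn_wge0// subr_ge0.
Qed.

Lemma continuous_tanh : continuous (@tanh R).
Proof.
move=> x; apply: cvgM; last first.
  apply: cvgV; first by rewrite gt_eqF// addr_gt0// expR_gt0.
  apply: cvgD; first exact: continuous_expR.
  by apply: continuous_comp; [exact: opp_continuous|exact: continuous_expR].
apply: cvgB; first exact: continuous_expR.
by apply: continuous_comp; [exact: opp_continuous|exact: continuous_expR].
Qed.

Let fib (s x : R) := tanh (kappa * x) * s.

Let fib_cont s : continuous (fib s).
Proof.
move=> x; apply: cvgM; last exact: cvg_cst.
by apply: continuous_comp; [exact: mulrl_continuous|exact: continuous_tanh].
Qed.

Let fib0 s : fib s 0 = 0.
Proof. by rewrite /fib mulr0 tanh0 mul0r. Qed.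

Let fib_mono s : {homo fib s : x y / x <= y} \/ {homo fib s : x y / x <= y >-> y <= x}.
Proof.
have [k0|k0] := leP 0 kappa; have [s0|s0] := leP 0 s.
- by left=> x y xy; apply: ler_wpM2r => //; apply/tanh_le/ler_wpM2l.
- right=> x y xy; apply: ler_wnM2r; first exact: ltW.
  exact/tanh_le/ler_wpM2l.
- right=> x y xy; apply: ler_wpM2r => //.
  by apply/tanh_le/ler_wnM2l => //; exact: ltW.
- left=> x y xy; apply: ler_wnM2r; first exact: ltW.
  by apply/tanh_le/ler_wnM2l => //; exact: ltW.
Qed.

Let fib_seg s a : fib s @` seg a = seg (fib s a).
Proof.
apply/seteqP; split.
  move=> _ [x xa <-]; rewrite /seg/= -(fib0 s).
  by case: (fib_mono s) => m; case: xa => /andP[? ?];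
    [left|right|right|left]; rewrite !m.
move=> z za.
have [a0|a0] := leP 0 a.
  have [||x xa <-] := @IVT R (fib s) 0 a z a0.
  - exact/continuous_subspaceT/fib_cont.
  - rewrite fib0 ge_min le_max.
    by case: za => /andP[-> ->]; rewrite ?orbT.
  by exists x => //; left; move: xa; rewrite in_itv.
have [||x xa <-] := @IVT R (fib s) a 0 z (ltW a0).
- exact/continuous_subspaceT/fib_cont.
- rewrite fib0 ge_min le_max.
  by case: za => /andP[-> ->]; rewrite ?orbT.
by exists x => //; right; move: xa; rewrite in_itv.
Qed.

Lemma frac_circle x : circle (frac x).
Proof.
rewrite /circle/= in_itv/= /frac subr_ge0 floor_le_tmp/= ltrBlDr addrC.
by rewrite -intrD1 floorD1_gt.
Qed.

Lemma fracK theta : circle theta -> frac (frac (theta - rho) + rho) = theta.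
Proof.
rewrite /circle/= in_itv/= => /andP[t0 t1].
set k := Num.floor (theta - rho).
have e : frac (theta - rho) + rho = theta + (- k)%:~R.
  by rewrite /frac -/k mulrNz addrAC subrK.
rewrite e /frac (_ : Num.floor (theta + (- k)%:~R) = - k) ?addrK//.
by apply: floor_def; rewrite intrD lerDr t0/= addrC ltrD2l.
Qed.

Lemma frac_inj theta theta' : circle theta ->
  frac (theta + rho) = theta' -> theta = frac (theta' - rho).
Proof.
rewrite /circle/= in_itv/= => /andP[t0 t1] <-.
set k := Num.floor (theta + rho).
have e : frac (theta + rho) - rho = theta + (- k)%:~R.
  by rewrite /frac -/k mulrNz addrAC addrK.
rewrite e /frac (_ : Num.floor (theta + (- k)%:~R) = - k) ?addrK//.
by apply: floor_def; rewrite intrD lerDr t0/= addrC ltrD2l.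
Qed.

Let back theta := frac (theta - rho).

Fixpoint bounding_line (n : nat) (theta : R) : R :=
  if n is m.+1 then
    tanh (kappa * bounding_line m (back theta)) * sin (pi * back theta)
  else 1.

Let psi := bounding_line.

Let iter_skew n theta x : (iter n (skew rho kappa) @` cylinder) (theta, x) <->
  circle theta /\ seg (psi n theta) x.
Proof.
elim: n theta x => [|n ih] theta x /=.
  split=> [[[t y] [/= ct x01] [te ye]]|[ct x01]].
    by rewrite -te -ye; split=> //; left; move: x01; rewrite in_itv.
  exists (theta, x) => //; split=> //=; rewrite in_itv/=.
  by case: x01 => // /andP[h1 h2]; have := le_trans h1 h2; rewrite ler10.
split.
  case=> p pc; rewrite /skew.
  set q := iter n _ p => -[q1 q2].
  have : (iter n (skew rho kappa) @` cylinder) (q.1, q.2).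
    by exists p => //; rewrite -surjective_pairing.
  move=> /ih[cq sq].
  have e : q.1 = back theta by exact: frac_inj.
  split; first by rewrite -q1; exact: frac_circle.
  rewrite -/(fib (sin (pi * back theta)) (psi n (back theta))) -fib_seg.
  by exists q.2; rewrite ?e// -e.
case=> ct; rewrite -/(fib (sin (pi * back theta)) (psi n (back theta))).
rewrite -fib_seg => -[y sy yx].
have /ih[p pc pe] : circle (back theta) /\ seg (psi n (back theta)) y.
  by split => //; exact: frac_circle.
by exists p => //; rewrite pe /skew/= fracK// -yx.
Qed.

Let attractorE theta x : attractor rho kappa (theta, x) <->
  circle theta /\ forall n, seg (psi n theta) x.
Proof.
split=> [h|[ct h] n _]; last by apply/iter_skew; split.
split; first by have /iter_skew[] := h 0 I.
by move=> n; have /iter_skew[] := h n I.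
Qed.

Let graph_ge a theta : 0 < a -> circle theta ->
  (a <= upper_graph rho kappa theta) <-> forall n, a <= psi n theta.
Proof.
move=> a0 ct; set S := [set x | x \in `[0, 1] /\ attractor rho kappa (theta, x)].
have S1 : ubound S 1 by move=> x [] /itvP ->.
have hS : has_sup S.
  split; last by exists 1.
  exists 0; split; first by rewrite in_itv/= lexx ler01.
  apply/attractorE; split=> // n; rewrite /seg/= lexx andbT/=.
  by case: (leP 0 (psi n theta)) => ?; [left|right; exact: ltW].
split=> [aS n|h]; last first.
  apply: ub_le_sup; first by exists 1.
  split; last by apply/attractorE; split=> // n; left; rewrite h ltW.
  by rewrite in_itv/= ltW//=; exact: (h 0%N).
apply/ler_addgt0Pr => e e0.
rewrite -lerBlDr; set b := a - Num.min e (a / 2).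
have m0 : 0 < Num.min e (a / 2) by rewrite lt_min e0 divr_gt0.
have b0 : 0 < b by rewrite subr_gt0 gt_min [X in _ || X]ltr_pdivrMr// ltr_pMr ?ltr1n ?orbT.
have [x [_ /attractorE[_ /(_ n) sx]] bx] := sup_adherent m0 hS.
have bx' : b < x by apply: le_lt_trans bx; rewrite lerB.
have x0 := lt_trans b0 bx'.
case: sx => /andP[h1 h2]; last by move: h2; rewrite leNgt x0.
apply: le_trans (_ : b <= _).
  by rewrite lerB// ge_min lexx.
exact: le_trans (ltW bx') h2.
Qed.

Let graph_ge0 theta : 0 <= upper_graph rho kappa theta.
Proof.
rewrite /upper_graph; set S := [set x | _].
have [->|/set0P[x [/itvP x01 xS]]] := eqVneq S set0; first by rewrite sup0.
apply: (@le_trans _ _ x); first by rewrite x01.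
apply: ub_le_sup; last by split=> //; rewrite in_itv/= !x01.
by exists 1 => y [/itvP ->].
Qed.

Let measurable_frac : measurable_fun setT (@frac R).
Proof.
apply: measurable_funB => //; apply: nondecreasing_measurable => //.
by move=> x y xy; rewrite ler_int le_floor.
Qed.

Let measurable_tanh : measurable_fun setT (@tanh R).
Proof. by apply: continuous_measurable_fun; exact: continuous_tanh. Qed.

Let measurable_back : measurable_fun setT back.
Proof.
apply: (measurableT_comp measurable_frac).
exact: measurable_funB.
Qed.

Let measurable_psi n : measurable_fun setT (psi n).
Proof.
elim: n => [|n ih] /=; first exact: measurable_cst.
apply: measurable_funM.
  apply: (measurableT_comp measurable_tanh); apply: measurable_funM => //.
  exact: measurableT_comp ih measurable_back.
have ms : measurable_fun setT (@sin R).
  by apply: continuous_measurable_fun; exact: continuous_sin.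
by apply: (measurableT_comp ms); exact: measurable_funM.
Qed.

Let measurable_circle : measurable (@circle R).
Proof. exact: measurable_itv. Qed.

Let graph_out theta : ~ circle theta -> upper_graph rho kappa theta = 0.
Proof.
move=> nct; rewrite /upper_graph (_ : [set x | _] = set0) ?sup0//.
by rewrite -subset0 => x [_ /attractorE[]].
Qed.

Lemma measurable_upper_graph : measurable_fun setT (upper_graph rho kappa).
Proof.
apply: (measurability (@RGenCInfty.G R)) => [|/= _ [_] [a] -> <-].
  exact: RGenCInfty.measurableE.
have [a0|a0] := leP a 0.
  rewrite (_ : _ `&` _ = setT)//; apply/seteqP; split=> // x _.
  by split=> //=; rewrite in_itv/= andbT (le_trans a0).
rewrite (_ : _ `&` _ =
  circle `&` \bigcap_(n in [set: nat]) (psi n @^-1` `[a, +oo[)).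
  apply: measurableI => //; apply: bigcapT_measurable => n.
  by rewrite -[X in measurable X]setTI; apply: measurable_psi.
apply/seteqP; split=> x /=.
  case=> _; rewrite in_itv/= andbT => ax.
  have cx : circle x.
    by apply: contrapT => /graph_out x0; move: ax; rewrite x0 leNgt a0.
  split=> // n _ /=; rewrite in_itv/= andbT.
  by move: n; apply/graph_ge.
move=> [cx h]; split=> //=; rewrite in_itv/= andbT.
apply/(graph_ge a0 cx) => n.
by have := h n I; rewrite /= in_itv/= andbT.
Qed.

Let mu_graphE A : mu_graph rho kappa A =
  lebesgue_measure (circle `&` (fun t => (t, upper_graph rho kappa t)) @^-1` A).
Proof.
congr lebesgue_measure; apply/seteqP; split=> t /=.
  by move=> [p [Ap [s cs sp]] <-]; rewrite -sp in Ap *; split.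
by move=> [ct At]; exists (t, upper_graph rho kappa t) => //; split=> //; exists t.
Qed.

Let measurable_graph_pre (A : set (R * R)) : measurable A ->
  measurable (circle `&` (fun t => (t, upper_graph rho kappa t)) @^-1` A).
Proof.
move=> mA.
apply: measurableI => //.
have mg : measurable_fun setT (fun t => (t, upper_graph rho kappa t)).
  by apply: measurable_fun_pair; [exact: measurable_id|exact: measurable_upper_graph].
by rewrite -[X in measurable X]setTI; exact: mg.
Qed.

Let mu_graph0 : mu_graph rho kappa set0 = 0.
Proof. by rewrite mu_graphE preimage_set0 setI0 measure0. Qed.

Let mu_graph_ge0 A : (0 <= mu_graph rho kappa A)%E.
Proof. exact: measure_ge0. Qed.

Let mu_graph_sigma_additive : semi_sigma_additive (mu_graph rho kappa).
Proof.
move=> F mF tF mUF; rewrite mu_graphE preimage_bigcup setI_bigcupr.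
rewrite (_ : (fun n => _) = fun n => (\sum_(0 <= i < n) lebesgue_measure
   (circle `&` (fun t => (t, upper_graph rho kappa t)) @^-1` F i))%E); last first.
  by apply/funext => n; apply: eq_bigr => i _; exact: mu_graphE.
apply: measure_semi_sigma_additive.
- by move=> n; exact: measurable_graph_pre.
- apply/trivIsetP => /= i j _ _ ij; rewrite setIACA setIid -preimage_setI.
  by move/trivIsetP : tF => /(_ _ _ _ _ ij) ->//; rewrite preimage_set0 setI0.
- by apply: bigcupT_measurable => n; exact: measurable_graph_pre.
Qed.

HB.instance Definition _ := isMeasure.Build _ _ _ (mu_graph rho kappa)
  mu_graph0 mu_graph_ge0 mu_graph_sigma_additive.

Let mu_graph_fin : fin_num_fun (mu_graph rho kappa).
Proof.
apply: lty_fin_num_fun.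
rewrite /= mu_graphE preimage_setT setIT lebesgue_measure_itv/= lte_fin ltr01.
by rewrite -EFinD ltry.
Qed.

HB.instance Definition _ :=
  @Measure_isFinite.Build _ _ _ (mu_graph rho kappa) mu_graph_fin.

End mu_graph_measure.

(* Main.v *)
Require Import Defs.
From mathcomp Require Import all_boot all_order all_algebra.
From mathcomp Require Import all_classical all_reals all_analysis.
From mathcomp Require Import measurable_realfun ring lra zify.

(**
The graph measure is the lift of Lebesgue measure to the upper bounding graph,
so a small ball of radius e has measure at most 2 e and the pointwise dimension is at
least 1. The opposite bound holds because the graph is rectifiable: up to a null
set, the circle is a countable union of sets on which the graph is Lipschitz
([upper_graph_lip]), and at a Lebesgue density point of such a set a ball of
radius e has measure at least a constant times e ([pointwise_dim_density]).

The graph is the infimum of the bounding lines psi_n, the images of the line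
x = 1. To compare psi_n at t and t', follow both points backwards. One fibre step
multiplies the difference by the slope of x |-> tanh (kappa x) and adds an error
of at most pi |t - t'| from the sine. With kappa = s^2, the slope is at most
64 / s^2 as long as both lines stay above the level s / kappa, and at most
2 s^2 always. So if the lines are below that level during at most an eighth of
the time along each of the two orbits, then the accumulated slopes decay
geometrically, and the psi_n are Lipschitz with a common constant
([bounding_line_lip]).

A bounding line is small only because of recent visits of the backward orbit to
the zero of the sine. Quantitatively, if q_j denotes the distance of the j-th
preimage to 0, a bad time starts a window on which -ln q_j has average at least
ln kappa / 4 ([bad_time_window]). By the Diophantine condition visits close to 0
are far apart in time, and a divide and conquer argument shows that the sum of
-ln q_j over a window of length m is O(m), with a constant depending only on c
and d, apart from the largest term ([sum_window_pow2]). If q_j is at least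
2^-j / (M + 1) up to a shift of the index, then this largest term is at most
linear in j, and a rising sun covering by disjoint windows bounds the density of
bad times as soon as ln kappa is large compared with that constant
([bad_density]). The condition with some M holds for almost every angle, because
the excluded sets have measure O(1 / M) ([lebesgue_not_slow_recurrence]).
*)

Set Implicit Arguments.
Unset Strict Implicit.
Unset Printing Implicit Defensive.

Import Order.TTheory GRing.Theory Num.Theory.
Import numFieldNormedType.Exports.
(* [frac], [skew] and [fracK] also name notions of the algebra libraries. *)
Import Defs.

Local Open Scope classical_set_scope.
Local Open Scope ring_scope.

(** * The hyperbolic tangent *)

Lemma tanhE (R : realType) (x : R) : tanh x = 1 - 2 / (expR (2 * x) + 1).
Proof.
have x0 := expR_gt0 x.
rewrite /tanh mulr_natl expRM_natl expRN.
have h1 : expR x ^+ 2 + 1 != 0 by rewrite gt_eqF// ltr_wpDl// sqr_ge0.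
have h2 : expR x != 0 by rewrite gt_eqF.
by field; rewrite h2 -?expr2 h1.
Qed.

Lemma tanh_ge0 (R : realType) (x : R) : 0 <= x -> 0 <= tanh x.
Proof. by move=> x0; rewrite -(@tanh0 R) tanh_le. Qed.

Lemma tanh_le1 (R : realType) (x : R) : tanh x <= 1.
Proof. by rewrite tanhE gerBl divr_ge0// addr_ge0// expR_ge0. Qed.

Lemma tanh_ge_min (R : realType) (x : R) : 0 <= x -> Num.min 1 x / 2 <= tanh x.
Proof.
move=> x0; rewrite tanhE.
have h : 2 / (expR (2 * x) + 1) <= (1 + x)^-1.
  have e := expR_ge1Dx (2 * x).
  rewrite ler_pdivrMr; last by lra.
  rewrite mulrC ler_pdivlMr; lra.
apply: le_trans (_ : 1 - (1 + x)^-1 <= _); last by rewrite lerB.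
have -> : 1 - (1 + x)^-1 = x / (1 + x) by field; rewrite gt_eqF//; lra.
rewrite ler_pdivlMr; last lra.
by have [x1|x1] := leP 1 x; nra.
Qed.

(** Mean value bound with the derivative at the smaller end [z], up to a
    constant: [4 / (expR (2 * z) + 1)] dominates the derivative of [tanh] on
    [z, +oo[. *)
Lemma tanh_diff_le (R : realType) (z x y : R) : 0 <= z -> z <= x -> z <= y ->
  `|tanh x - tanh y| <= 4 / (expR (2 * z) + 1) * `|x - y|.
Proof.
move=> z0; wlog xy : x y / y <= x => [hw zx zy|_ zy].
  have [yx|/ltW xy] := leP y x; first exact: hw.
  by rewrite distrC [X in _ * X]distrC; exact: hw.
rewrite !ger0_norm ?subr_ge0 ?tanh_le// !tanhE.
have hd : expR (2 * y) >= expR (2 * x) * (1 - 2 * (x - y)).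
  have -> : 2 * y = 2 * x + - (2 * (x - y)) by ring.
  rewrite [leRHS]expRD ler_wpM2l ?expR_ge0//.
  by have := expR_ge1Dx (- (2 * (x - y))); lra.
have hz : expR (2 * z) <= expR (2 * y) by rewrite ler_expR ler_wpM2l.
have X0 := expR_gt0 (2 * x); have Y0 := expR_gt0 (2 * y).
have Z0 := expR_gt0 (2 * z).
move: hd hz X0 Y0 Z0; set X := expR (2 * x); set Y := expR (2 * y).
set Z := expR (2 * z) => hd hz X0 Y0 Z0.
apply: (@le_trans _ _ (4 / (Y + 1) * (x - y))); last first.
  rewrite ler_wpM2r ?subr_ge0// ler_wpM2l// lef_pV2 ?posrE; lra.
have -> : 1 - 2 / (X + 1) - (1 - 2 / (Y + 1)) =
    (Y + 1)^-1 * (2 * (X - Y) / (X + 1)).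
  by field; rewrite !gt_eqF//=; lra.
rewrite [4 / _]mulrC -[leRHS]mulrA ler_wpM2l ?invr_ge0//; first lra.
rewrite ler_pdivrMr; last lra.
nra.
Qed.

Lemma tanh_lip (R : realType) (x y : R) : 0 <= x -> 0 <= y ->
  `|tanh x - tanh y| <= 2 * `|x - y|.
Proof.
move=> x0 y0; have := @tanh_diff_le R 0 x y (lexx _) x0 y0.
by rewrite mulr0 expR0 (_ : 4 / (1 + 1) = 2)//; field.
Qed.

(** The slope of [tanh] decays exponentially. With [kappa = s ^+ 2] this bound
    makes [x |-> tanh (kappa * x)] contract by [64 / s ^+ 2] on [kappa * x >= s]. *)
Lemma tanh_lip_far (R : realType) (s x y : R) : 0 < s -> s <= x -> s <= y ->
  `|tanh x - tanh y| <= 64 / s ^+ 4 * `|x - y|.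
Proof.
move=> s0 sx sy; apply: le_trans (tanh_diff_le (ltW s0) sx sy) _.
rewrite ler_wpM2r//.
have h : s ^+ 4 / 16 <= expR (2 * s).
  have -> : 2 * s = 4 * (s / 2) by field.
  rewrite expRM_natl (_ : s ^+ 4 / 16 = (s / 2) ^+ 4); last by field.
  rewrite ler_pXn2r ?nnegrE ?expR_ge0//; last lra.
  by have := expR_ge1Dx (s / 2); lra.
have s4 : 0 < s ^+ 4 by rewrite exprn_gt0.
rewrite ler_pdivrMr; last by have := expR_gt0 (2 * s); lra.
rewrite mulrAC ler_pdivlMr//; lra.
Qed.

(** * Distance to the integers and the sine *)

Lemma circleE (R : realType) (t : R) : circle t <-> 0 <= t < 1.
Proof. by rewrite /circle/= in_itv. Qed.

Lemma frac_itv (R : realType) (x : R) : 0 <= frac x < 1.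
Proof. by apply/circleE; exact: frac_circle. Qed.

Lemma dist_int_le (R : realType) (x : R) (k : int) :
  dist_int x <= `|x - k%:~R|.
Proof.
apply: ge_inf; last by exists k.
by exists 0 => _ [l _ <-].
Qed.

Lemma dist_int_ge0 (R : realType) (x : R) : 0 <= dist_int x.
Proof.
apply: lb_le_inf; first by exists `|x - 0%:~R|, 0.
by move=> _ [l _ <-].
Qed.

Lemma dist_int_lt (R : realType) (x e : R) : dist_int x < e ->
  exists k : int, `|x - k%:~R| < e.
Proof.
move=> xe; set S := [set `|x - k%:~R| | k in [set: int]].
have hi : has_inf S.
  by split; [exists `|x - 0%:~R|, 0|exists 0 => _ [l _ <-]].
have e0 : 0 < e - dist_int x by rewrite subr_gt0.
have [_ [k _ <-] h] := inf_adherent e0 hi.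
by exists k; move: h; rewrite -/(dist_int x) addrCA subrr addr0.
Qed.

Lemma dist_intB (R : realType) (x y : R) :
  dist_int (x - y) <= dist_int x + dist_int y.
Proof.
apply/ler_addgt0Pr => e e0.
have [|k hk] := @dist_int_lt R x (dist_int x + e / 2); first lra.
have [|l hl] := @dist_int_lt R y (dist_int y + e / 2); first lra.
apply: le_trans (dist_int_le _ (k - l)) _.
rewrite intrD mulrNz (_ : x - y - _ = (x - k%:~R) - (y - l%:~R)); last by ring.
by apply: le_trans (ler_normB _ _) _; lra.
Qed.

Lemma dist_int_norm (R : realType) (x : R) : dist_int x <= `|x|.
Proof. by have := dist_int_le x 0; rewrite subr0. Qed.

Lemma dist_int_le1 (R : realType) (x : R) : dist_int x <= 1.
Proof.
apply: le_trans (dist_int_le x (Num.floor x)) _.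
have /andP[h0 h1] := frac_itv x.
by rewrite ger0_norm// ltW.
Qed.

(** [x |-> `|sin (pi * x)|] has period 1, so that [sin] on the fundamental
    domain extends to a Lipschitz function of the circle. *)
Lemma sin_piD_norm (R : realType) (x : R) (k : int) :
  `|sin (pi * (x + k%:~R))| = `|sin (pi * x)|.
Proof.
have h n y : `|sin (pi * (y + n%:R))| = `|sin (pi * y)| :> R.
  elim: n y => [|n ih] y; first by rewrite addr0.
  rewrite -natr1 addrA mulrDr mulr1 sinDpi normrN.
  exact: ih.
case: k => n; first exact: h.
rewrite NegzE mulrNz -(h n.+1) -addrA; congr (`|sin (pi * _)|).
by rewrite pmulrn addrA subrK.
Qed.

Lemma sin_pi_frac (R : realType) (x : R) : sin (pi * frac x) = `|sin (pi * x)|.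
Proof.
rewrite /frac -mulrNz -(sin_piD_norm x (- Num.floor x)) ger0_norm//.
have /andP[h0 h1] := frac_itv x.
have p0 := @pi_ge0 R; rewrite mulrNz; apply: sin_ge0_pi.
by rewrite mulr_ge0//= ler_piMr// ltW.
Qed.

Lemma sin_lip (R : realType) (x y : R) : `|sin x - sin y| <= `|x - y|.
Proof.
wlog xy : x y / y <= x => [hw|].
  have [yx|/ltW xy] := leP y x; first exact: hw.
  by rewrite distrC [leRHS]distrC; exact: hw.
have [z _ ->] := @MVT_segment R sin cos y x xy
  (fun t _ => is_derive_sin t) (continuous_subspaceT (@continuous_sin R)).
by rewrite normrM ler_piMl// cos_max.
Qed.

Lemma norm_sin_pi_lip (R : realType) (x y : R) :
  `| `|sin (pi * x)| - `|sin (pi * y)| | <= pi * `|x - y|.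
Proof.
apply: le_trans (ler_dist_dist _ _) _.
apply: le_trans (sin_lip _ _) _.
by rewrite -mulrBr normrM ger0_norm// pi_ge0.
Qed.

(** Two regimes: up to [pi / 4] the mean value theorem and [cos >= 1 / 2] give
    [sin (pi * t) >= pi * t / 2 >= t]; beyond, [sin >= 1 / 2 >= t]. *)
Lemma sin_pi_ge (R : realType) (t : R) : 0 <= t <= 1 / 2 -> t <= sin (pi * t).
Proof.
move=> /andP[t0 t1]; have p2 := @pi_ge2 R; have p0 := @pi_gt0 R.
have s4 : 1 / 2 <= sin (pi / 4) :> R /\ 1 / 2 <= cos (pi / 4) :> R.
  have c0 : 0 < cos (pi / 4) :> R by apply: cos_gt0_pihalf; apply/andP; split; lra.
  have := @tan_piquarter R; rewrite /tan => ht.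
  have h := @cos2Dsin2 R (pi / 4).
  have e : sin (pi / 4) = cos (pi / 4) :> R.
    by rewrite -[LHS](mulfVK (lt0r_neq0 c0)) ht mul1r.
  rewrite e in h; split; nra.
have m x y : - (pi / 2) <= x <= pi / 2 -> - (pi / 2) <= y <= pi / 2 ->
  x <= y -> sin x <= sin y :> R.
  move=> hx hy; rewrite le_eqVlt => /predU1P[->//|xy].
  by rewrite ltW// ltr_sin ?in_itv.
have pt0 : 0 <= pi * t by apply: mulr_ge0 => //; lra.
have pt1 : pi * t <= pi * (1 / 2) by rewrite ler_wpM2l// ltW.
have [h|h] := leP (pi * t) (pi / 4); last first.
  apply: le_trans t1 (le_trans s4.1 (m _ _ _ _ (ltW h))).
    by apply/andP; split; lra.
  by apply/andP; split; lra.
have [z zz] := @MVT_segment R sin cos 0 (pi * t) pt0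
  (fun t _ => is_derive_sin t) (continuous_subspaceT (@continuous_sin R)).
rewrite sin0 !subr0 => ->.
have cz : 1 / 2 <= cos z.
  apply: le_trans s4.2 _.
  move: zz; rewrite in_itv/= => /andP[z0 z1].
  rewrite -[cos (pi / 4)]cosN -[cos z]cosN -!sinDpihalf.
  by apply: m; [apply/andP; split; lra|apply/andP; split; lra|lra].
nra.
Qed.

Lemma dist_int_le_sin (R : realType) (x : R) : dist_int x <= `|sin (pi * x)|.
Proof.
have /andP[h0 h1] := frac_itv x.
rewrite -sin_pi_frac; have [h|h] := leP (frac x) (1 / 2).
  apply: le_trans (dist_int_le x (Num.floor x)) _.
  by rewrite ger0_norm// sin_pi_ge// h0.
have e : sin (pi * frac x) = sin (pi * (1 - frac x)).
  by rewrite [in RHS]mulrBr mulr1 sinB sinpi cospi; ring.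
rewrite e; apply: le_trans (dist_int_le x (Num.floor x + 1)) _.
rewrite (_ : x - _ = - (1 - frac x)); last by rewrite /frac intrD; ring.
rewrite normrN ger0_norm; last lra.
by apply: sin_pi_ge; apply/andP; split; lra.
Qed.

(** * Sums over windows and bad times *)

(** [w j] stands for minus the logarithm of the distance to 0 of the
    [(j + 1)]-st preimage of an angle. By [w_sep] two large values of [w]
    cannot be close in time. *)
Section rising_sun.
Context {R : realType} (w : nat -> R) (d beta : R).
Hypotheses (w_ge0 : forall j, 0 <= w j) (d_ge0 : 0 <= d) (beta_ge0 : 0 <= beta).
Hypothesis w_sep : forall j k, (j < k)%N ->
  Num.min (w j) (w k) <= beta + d * ln (k - j)%:R.

(* The bound on the averages of [w] over windows. *)
Let A := 2 * d + beta.

Let A_ge0 : 0 <= A. Proof. by rewrite addr_ge0 ?mulr_ge0. Qed.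

Lemma w_sep_pow2 j k p : j != k -> (j < k + 2 ^ p)%N -> (k < j + 2 ^ p)%N ->
  Num.min (w j) (w k) <= beta + d * p%:R.
Proof.
wlog jk : j k / (j < k)%N => [hw jk h1 h2|_ _ h].
  have [?|?|e] := ltngtP j k; first exact: hw.
    by rewrite minC hw// eq_sym.
  by rewrite e eqxx in jk.
apply: le_trans (w_sep jk) _; rewrite lerD2l ler_wpM2l//.
have h1 : (k - j <= 2 ^ p)%N by rewrite leq_subLR ltnW.
have h0 : (0 < k - j)%N by rewrite subn_gt0.
apply: (@le_trans _ _ (ln (2 ^+ p))).
  by rewrite ler_ln ?posrE ?ltr0n ?exprn_gt0// -natrX ler_nat.
rewrite lnXn// -[ln _ *+ _]mulr_natl ler_piMr//.
by have := @le_ln1Dx R 1; rewrite (_ : 1 + 1 = 2)//; apply.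
Qed.

(** Apart from its largest term, a window of length [2 ^ p] has sum at most
    [A * 2 ^+ p]. Induction on [p]: when two halves are joined, only the smaller
    of their two largest terms has to be absorbed, and [w_sep] bounds it by
    [beta + d * p.+1%:R]. The subtracted [d * p%:R + A] is what lets the
    induction absorb these linear errors. *)
Lemma sum_window_pow2 p i : exists j,
  [/\ (i <= j < i + 2 ^ p)%N,
      forall k, (i <= k < i + 2 ^ p)%N -> w k <= w j &
      \sum_(i <= k < i + 2 ^ p) w k <= A * 2 ^+ p - (d * p%:R + A) + w j].
Proof.
elim: p i => [|p ih] i.
  exists i; split; first by rewrite leqnn expn0 addn1 leqnn.
    by move=> k; rewrite addn1 ltnS -eqn_leq => /eqP ->.
  by rewrite expn0 addn1 big_nat1 expr0 !mulr0 mulr1 add0r subrr add0r.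
have [j1 [j1i m1 s1]] := ih i.
have [j2 [j2i m2 s2]] := ih (i + 2 ^ p)%N.
have e : (i + 2 ^ p.+1 = i + 2 ^ p + 2 ^ p)%N by rewrite expnS mul2n -addnn addnA.
have es : \sum_(i <= k < i + 2 ^ p.+1) w k <=
    A * 2 ^+ p.+1 - (d * p.+1%:R + A) + Num.max (w j1) (w j2).
  rewrite (@big_cat_nat _ _ _ (i + 2 ^ p)%N)/= ?leq_addr//; last first.
    by rewrite e leq_addr.
  rewrite e.
  have hm : Num.min (w j1) (w j2) <= beta + d * p.+1%:R.
    apply: w_sep_pow2.
    - by move: j1i j2i; lia.
    - by rewrite expnS mul2n; move: j1i j2i; lia.
    - by rewrite expnS mul2n; move: j1i j2i; lia.
  have hmm : Num.min (w j1) (w j2) + Num.max (w j1) (w j2) = w j1 + w j2.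
    by rewrite addr_min_max.
  apply: le_trans (lerD s1 s2) _.
  rewrite exprS -natr1 in hm *; rewrite /A in hm *.
  lra.
have [j12|j12] := leP (w j1) (w j2).
  exists j2; split; first by move: j1i j2i; lia.
  - move=> k hk; have [h|h] := ltnP k (i + 2 ^ p)%N.
      by apply: le_trans (m1 _ _) j12; lia.
    by apply: m2; lia.
  - by move: es; rewrite (max_idPr j12).
exists j1; split; first by move: j1i j2i; lia.
- move=> k hk; have [h|h] := ltnP k (i + 2 ^ p)%N.
    by apply: m1; lia.
  by apply: le_trans (m2 _ _) (ltW j12); lia.
- by move: es; rewrite (max_idPl (ltW j12)).
Qed.

Variable C : nat.
Hypothesis w_lin : forall j, w j <= j%:R + C%:R.

Lemma sum_window i m :
  \sum_(i <= k < i + m) w k <= (A * 2 + 2) * m%:R + i%:R + C%:R.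
Proof.
have A0 := A_ge0.
case: m => [|m].
  by rewrite addn0 big_geq// mulr0 add0r addr_ge0.
have [p hp1 hp2] : exists2 p, (m.+1 <= 2 ^ p)%N & (2 ^ p <= m.+1.*2)%N.
  case: m => [|m]; first by exists 0%N.
  have /andP[h1 h2] := @up_log_bounds 2 m.+2 isT isT.
  exists (up_log 2 m.+2) => //.
  move: h1; case: (up_log 2 m.+2) => [//|p] /=.
  rewrite expnS mul2n leq_double; exact: ltnW.
have [j [ji _ s]] := sum_window_pow2 p i.
apply: (@le_trans _ _ (\sum_(i <= k < i + 2 ^ p) w k)).
  rewrite [leRHS](@big_cat_nat _ _ _ (i + m.+1)%N) ?leq_addr ?leq_add2l//=.
  by rewrite lerDl sumr_ge0.
apply: le_trans s _.
have h1 : (2 ^+ p : R) <= 2 * m.+1%:R.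
  by rewrite -natrX -natrM ler_nat mul2n.
have h2 : w j <= i%:R + 2 * m.+1%:R + C%:R.
  apply: le_trans (w_lin j) _; rewrite lerD2r -natrM -natrD ler_nat mul2n.
  by move: ji => /andP[_ ji]; apply: ltnW; apply: leq_trans ji _; rewrite leq_add2l.
have h3 : 0 <= d * p%:R by rewrite mulr_ge0.
have h4 : A * 2 ^+ p <= A * (2 * m.+1%:R) by rewrite ler_wpM2l.
lra.
Qed.

Variables (a : R) (bad : pred nat).
Hypothesis bad_window : forall i, bad i ->
  exists2 m, (0 < m)%N & a * m%:R <= \sum_(i <= k < i + m) w k.

(** Rising sun argument: the bad times of [[i, i + n[] are covered by disjoint
    windows on each of which [w] has average at least [a]. The last window may
    stick out of [[i, i + n[], up to [e]. *)
Lemma rising_sun_cover n i : 0 <= a -> exists e,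
  [/\ (i + n <= e)%N,
      e = (i + n)%N \/ (exists j m, [/\ (j < i + n)%N, e = (j + m)%N &
                             a * m%:R <= \sum_(j <= k < j + m) w k]) &
      a * (\sum_(i <= k < i + n) bad k)%N%:R <= \sum_(i <= k < e) w k].
Proof.
move=> a0; elim/ltn_ind: n i => -[|n] ih i.
  exists i; rewrite addn0; split=> //; first by left.
  by rewrite !big_geq// mulr0.
have [bi|nbi] := boolP (bad i); last first.
  have [e [h1 h2 h3]] := ih n (ltnSn n) i.+1.
  exists e; rewrite -addSnnS; split=> //.
  rewrite big_ltn ?ltnS ?leq_addr// (negbTE nbi) add0n.
  apply: le_trans h3 _.
  by rewrite [leRHS]big_ltn ?lerDr//; apply: leq_trans h1; rewrite addSn ltnS leq_addr.
have [m m0 hm] := bad_window bi.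
have hc (x y : nat) : (\sum_(x <= k < y) bad k <= y - x)%N.
  rewrite -[leqRHS]muln1 -sum_nat_const_nat; apply: leq_sum => k _.
  by case: (bad k).
have [nm|mn] := leqP n.+1 m.
  exists (i + m)%N; split; first by rewrite leq_add2l.
  - by right; exists i, m; split=> //; rewrite addnS ltnS leq_addr.
  - apply: le_trans hm; rewrite ler_wpM2l// ler_nat.
    by apply: leq_trans (hc _ _) _; rewrite addKn.
have [|e [h1 h2 h3]] := ih (n.+1 - m)%N _ (i + m)%N.
  by lia.
have e1 : (i + m + (n.+1 - m) = i + n.+1)%N by lia.
rewrite e1 in h1 h2 h3.
exists e; split=> //.
rewrite (@big_cat_nat _ _ _ (i + m)%N)/= ?leq_addr//; last by lia.
rewrite [leRHS](@big_cat_nat _ _ _ (i + m)%N)/= ?leq_addr//; last by lia.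
rewrite natrD mulrDr lerD//.
apply: le_trans hm; rewrite ler_wpM2l// ler_nat.
by apply: leq_trans (hc _ _) _; rewrite addKn.
Qed.

(** If [a] is large compared with the averages of [w], then at most an eighth of
    all times is bad, up to an additive constant. The last window of the cover
    starts at some [j < k] and has average at least [a]; by [sum_window] its
    length is at most [j + C]. *)
Lemma bad_density k : 32 * (A + 1) <= a ->
  (8 * \sum_(0 <= j < k) bad j <= k + C)%N.
Proof.
move=> ha; have A0 := A_ge0.
have a0 : 0 < a by lra.
have [e [_ h2 h3]] := rising_sun_cover k 0 (ltW a0).
rewrite add0n in h2 h3.
have ek : e%:R <= 2 * k%:R + C%:R :> R.
  have k0 : 0 <= k%:R :> R by [].
  have C0 : 0 <= C%:R :> R by [].
  case: h2 => [->|[j [m [jk -> hm]]]]; first lra.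
  have := le_trans hm (sum_window j m).
  have jk' : j%:R <= k%:R :> R by rewrite ler_nat ltnW.
  have m0 : 0 <= m%:R :> R by [].
  rewrite natrD; nra.
have s := sum_window 0 e; rewrite add0n addr0 in s.
have {}h3 := le_trans h3 s.
rewrite -(ler_nat R) natrM natrD.
move: h3; set N := (\sum_(0 <= j < k) bad j)%N%:R => h3.
have C0 : 0 <= C%:R :> R by [].
have h4 : (A * 2 + 2) * e%:R <= (A * 2 + 2) * (2 * k%:R + C%:R).
  by rewrite ler_wpM2l//; lra.
rewrite -(ler_pM2l a0).
have k0 : 0 <= k%:R :> R by [].
have h5 : 32 * (A + 1) * (k%:R + C%:R) <= a * (k%:R + C%:R).
  by rewrite ler_wpM2r//; lra.
nra.
Qed.

End rising_sun.

(** * The bounding lines along backward orbits *)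

(** The [j]-th preimage of the angle [t] under the rotation by [rho]. *)
Definition preimage_angle (R : realType) (rho t : R) (j : nat) : R :=
  frac (t - j%:R * rho).

(** The distance of the [(j + 1)]-st preimage of [t] to the zero of the sine.
    The shift by one makes [zero_dist rho t j] the quantity that governs the step
    from the [(j + 1)]-st to the [j]-th preimage. *)
Definition zero_dist (R : realType) (rho t : R) (j : nat) : R :=
  dist_int (t - j.+1%:R * rho).

Lemma frac_fracB (R : realType) (x y : R) : frac (frac x - y) = frac (x - y).
Proof.
rewrite /frac.
have -> : x - (Num.floor x)%:~R - y = (x - y) + (- Num.floor x)%:~R.
  by rewrite mulrNz; ring.
by rewrite floorDrz ?intr_int// intrD intrKfloor mulrNz; ring.
Qed.

Section backward_orbit.
Context {R : realType} (rho kappa : R).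
Hypothesis kappa_ge1 : 1 <= kappa.

Let kappa_ge0 : 0 <= kappa. Proof. exact: le_trans kappa_ge1. Qed.

Let psi := bounding_line rho kappa.
Let pre := preimage_angle rho.

Lemma sin_pi_circle_ge0 (t : R) : 0 <= sin (pi * frac t).
Proof. by rewrite sin_pi_frac. Qed.

Lemma bounding_line_itv n t : 0 <= psi n t <= 1.
Proof.
elim: n t => [|n ih] t; first by rewrite /psi/= ler01 lexx.
rewrite /psi/= -/psi sin_pi_frac.
set x := psi n _; have /andP[x0 x1] : 0 <= x <= 1 by exact: ih.
have h0 : 0 <= tanh (kappa * x) by rewrite tanh_ge0// mulr_ge0.
rewrite mulr_ge0//= -[leRHS]mulr1 ler_pM//; first exact: tanh_le1.
exact: sin_max.
Qed.

Lemma bounding_line_preS n t i : psi n.+1 (pre t i) =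
  tanh (kappa * psi n (pre t i.+1)) * `|sin (pi * (t - i.+1%:R * rho))|.
Proof.
rewrite /psi/= -/psi /pre /preimage_angle frac_fracB.
have -> : t - i%:R * rho - rho = t - i.+1%:R * rho by rewrite -natr1; ring.
by rewrite sin_pi_frac.
Qed.

(** One step maps [kappa * x] to at least
    [kappa * zero_dist / 2 * Num.min 1 (kappa * x)]. Hence a small value of a
    bounding line is explained by a small product of these factors, reaching
    back to the last time at which the minimum was 1; if there is none, the
    initial value [kappa] takes the place of 1. *)
Lemma bounding_line_small n t i (r : R) :
  0 < r -> r <= kappa -> (forall j, 0 < zero_dist rho t j) ->
  kappa * psi n (pre t i) < r ->
  exists2 m, (0 < m)%N & \prod_(i <= k < i + m) (kappa * zero_dist rho t k / 2) < r.
Proof.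
move=> r0 rk q0; elim: n i r r0 rk => [|n ih] i r r0 rk.
  by rewrite /psi/= mulr1 ltNge rk.
rewrite bounding_line_preS; set x := psi n _ => h.
have k0 : 0 < kappa by apply: lt_le_trans rk.
have /andP[x0 x1] : 0 <= x <= 1 by exact: bounding_line_itv.
have y0 : 0 < kappa * zero_dist rho t i / 2 by rewrite divr_gt0// mulr_gt0.
have {}h : kappa * zero_dist rho t i / 2 * Num.min 1 (kappa * x) < r.
  apply: le_lt_trans h.
  have -> : kappa * zero_dist rho t i / 2 * Num.min 1 (kappa * x) =
    kappa * (Num.min 1 (kappa * x) / 2 * zero_dist rho t i) by ring.
  rewrite ler_wpM2l// ler_pM//.
  - by rewrite divr_ge0// le_min ler01 mulr_ge0.
  - exact: dist_int_ge0.
  - by apply: tanh_ge_min; rewrite mulr_ge0.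
  - exact: dist_int_le_sin.
have [yr|ry] := ltP (kappa * zero_dist rho t i / 2) r.
  by exists 1%N => //; rewrite addn1 big_nat1.
set y := kappa * zero_dist rho t i / 2 in y0 h ry *.
have xr : kappa * x < r / y.
  rewrite ltr_pdivlMr// mulrC; apply: le_lt_trans (h).
  have [x2|x2] := leP 1 (kappa * x); last by [].
  exfalso; move: h; rewrite (min_idPl x2); rewrite mulr1 => h.
  by have := lt_le_trans h ry; rewrite ltxx.
have [||m m0 hm] := ih i.+1 (r / y) _ _ xr.
- by rewrite divr_gt0.
- by apply: le_trans kappa_ge1; rewrite ler_pdivrMr// mul1r.
exists m.+1 => //; rewrite big_ltn; last by rewrite addnS ltnS leq_addr.
rewrite -/y addnS -addSn mulrC -ltr_pdivlMr//.
Qed.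

(** At a bad time some bounding line is below the level [s / kappa], above
    which the fibre maps contract strongly. *)
Definition bad_time (s t : R) (i : nat) : bool :=
  `[< exists n, kappa * psi n (pre t i) < s >].

Lemma bad_time_window s t i : 1 <= s -> kappa = s ^+ 2 -> 4 <= ln kappa ->
  (forall j, 0 < zero_dist rho t j) -> bad_time s t i ->
  exists2 m, (0 < m)%N & ln kappa / 4 * m%:R <=
    \sum_(i <= k < i + m) - ln (zero_dist rho t k).
Proof.
move=> s1 ks lk q0 /asboolP[n].
have s0 : 0 < s by lra.
have sk : s <= kappa by rewrite ks expr2 ler_peMr// ltW.
have k0 : 0 < kappa by apply: lt_le_trans sk.
move=> /(bounding_line_small s0 sk q0)[m m0 hm]; exists m => //.
have y0 k : 0 < kappa * zero_dist rho t k / 2 by rewrite divr_gt0// mulr_gt0.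
have p0 : 0 < \prod_(i <= k < i + m) (kappa * zero_dist rho t k / 2).
  by rewrite prodr_gt0.
move: hm; rewrite -ltr_ln ?posrE//.
have -> : ln (\prod_(i <= k < i + m) (kappa * zero_dist rho t k / 2)) =
    \sum_(i <= k < i + m) (ln kappa - ln 2 + ln (zero_dist rho t k)).
  elim: {m0 p0} m => [|m ih]; first by rewrite addn0 !big_geq// ln1.
  rewrite addnS !big_nat_recr ?leq_addr//= lnM ?posrE ?prodr_gt0// ih.
  by rewrite ln_div ?posrE ?mulr_gt0// lnM ?posrE//; congr (_ + _); ring.
rewrite big_split/= sumr_const_nat addKn sumrN -[_ *+ m]mulr_natl.
have -> : ln s = ln kappa / 2 by rewrite ks lnXn// mulr2n; field.
have l2 : ln 2 <= 1 :> R.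
  by have := @le_ln1Dx R 1; rewrite (_ : 1 + 1 = 2)//; apply.
have m1 : 1 <= m%:R :> R by rewrite ler1n.
nra.
Qed.

(** One fibre step contracts by [64 / s ^+ 2] when the time is good for both
    points, and by at most [2 * s ^+ 2 <= 64 / s ^+ 2 * s ^+ 4] otherwise. *)
Lemma bounding_line_lip_step (s t t' : R) n i : 1 <= s -> kappa = s ^+ 2 ->
  `|psi n.+1 (pre t i) - psi n.+1 (pre t' i)| <=
  64 / s ^+ 2 * s ^+ (4 * (bad_time s t i.+1 + bad_time s t' i.+1)) *
    `|psi n (pre t i.+1) - psi n (pre t' i.+1)| + pi * `|t - t'|.
Proof.
move=> s1 ks; rewrite !bounding_line_preS.
set x := psi n (pre t _); set y := psi n (pre t' _).
set u := `|sin _|; set v := `|sin _|.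
have /andP[x0 x1] : 0 <= x <= 1 by exact: bounding_line_itv.
have /andP[y0 y1] : 0 <= y <= 1 by exact: bounding_line_itv.
have -> : tanh (kappa * x) * u - tanh (kappa * y) * v =
    (tanh (kappa * x) - tanh (kappa * y)) * u + tanh (kappa * y) * (u - v) by ring.
apply: le_trans (ler_normD _ _) _.
rewrite [X in X + _]normrM [X in _ + X](normrM (tanh _)).
apply: lerD; last first.
  have ty : `|tanh (kappa * y)| <= 1.
    by rewrite ger0_norm ?tanh_le1// tanh_ge0// mulr_ge0.
  have uv : `|u - v| <= pi * `|t - t'|.
    apply: le_trans (norm_sin_pi_lip _ _) _; rewrite ler_wpM2l ?pi_ge0//.
    by rewrite (_ : t - _ - (t' - _) = t - t')//; ring.
  by apply: le_trans (ler_pM _ _ ty uv) _; rewrite ?mul1r.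
apply: (@le_trans _ _ `|tanh (kappa * x) - tanh (kappa * y)|).
  by rewrite ler_piMr// normr_id sin_max.
have s2 : 1 <= s ^+ 2 by rewrite exprn_ege1.
have kxy : `|kappa * x - kappa * y| = s ^+ 2 * `|x - y|.
  by rewrite -mulrBr normrM ks ger0_norm// ltW//; lra.
have [gd|bd] := boolP (bad_time s t i.+1 || bad_time s t' i.+1).
  apply: le_trans (tanh_lip _ _) _; rewrite ?mulr_ge0//.
  rewrite kxy mulrA ler_wpM2r//.
  apply: (@le_trans _ _ (64 / s ^+ 2 * s ^+ 4)).
    rewrite (_ : _ * s ^+ 4 = 64 * s ^+ 2); first by rewrite ler_wpM2r//; lra.
    by field; rewrite gt_eqF//; lra.
  rewrite ler_wpM2l ?divr_ge0//; first lra.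
  rewrite ler_weXn2l// leq_pmulr//.
  by move: gd; case: (bad_time s t _) => //=; case: (bad_time s t' _).
move: bd; rewrite negb_or => /andP[/asboolPn bt /asboolPn bt'].
have sx : s <= kappa * x by rewrite leNgt; apply/negP => h; apply: bt; exists n.
have sy : s <= kappa * y by rewrite leNgt; apply/negP => h; apply: bt'; exists n.
apply: le_trans (tanh_lip_far _ sx sy) _; first lra.
rewrite kxy mulrA ler_wpM2r//.
apply: (@le_trans _ _ (64 / s ^+ 2)).
  by rewrite le_eqVlt; apply/orP; left; apply/eqP; field; rewrite gt_eqF//; lra.
by rewrite ler_peMr// ?exprn_ege1// divr_ge0//; lra.
Qed.

(** If, up to the constant [C], at most an eighth of the times is bad for each
    of two points, then the contraction over [k] steps is at most a constant times
    [(64 / s) ^+ k <= (1 / 2) ^+ k]; summing the errors that the sine commits at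
    each step gives a Lipschitz bound that does not depend on [n]. *)
Lemma bounding_line_lip (s t t' : R) (C : nat) n : 128 <= s -> kappa = s ^+ 2 ->
  (forall k, 8 * \sum_(0 <= j < k) bad_time s t j <= k + C)%N ->
  (forall k, 8 * \sum_(0 <= j < k) bad_time s t' j <= k + C)%N ->
  `|psi n (pre t 0) - psi n (pre t' 0)| <= 2 * pi * s ^+ C.+1 * `|t - t'|.
Proof.
move=> s128 ks bt bt'; have s1 : 1 <= s by lra.
pose la j := 64 / s ^+ 2 * s ^+ (4 * (bad_time s t j.+1 + bad_time s t' j.+1)).
have s2 : 1 <= s ^+ 2 by rewrite exprn_ege1.
have la0 j : 0 <= la j.
  by rewrite mulr_ge0 ?divr_ge0 ?exprn_ge0//; lra.
have sumle i : `|psi n (pre t i) - psi n (pre t' i)| <=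
    pi * `|t - t'| * \sum_(0 <= k < n) \prod_(i <= j < i + k) la j.
  elim: n i => [|m ih] i; first by rewrite subrr normr0 big_geq// mulr0.
  apply: le_trans (bounding_line_lip_step _ _ _ _ s1 ks) _; rewrite -/(la i).
  apply: le_trans (_ : la i * (pi * `|t - t'| *
      \sum_(0 <= k < m) \prod_(i.+1 <= j < i.+1 + k) la j) +
      pi * `|t - t'| <= _).
    by rewrite lerD2r ler_wpM2l.
  rewrite big_nat_recl// addn0 [X in _ <= _ * (X + _)]big_geq//.
  rewrite mulrDr mulr1 addrC lerD2l mulrCA ler_wpM2l ?mulr_ge0 ?pi_ge0//.
  rewrite mulr_sumr ler_sum// => k _.
  by rewrite [leRHS]big_ltn ?addnS ?addSn// ltnS leq_addr.
apply: le_trans (sumle 0%N) _.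
rewrite [leRHS](_ : _ = pi * `|t - t'| * (2 * s ^+ C.+1)); last by ring.
rewrite ler_wpM2l ?mulr_ge0 ?pi_ge0//.
have prodle k : \prod_(0 <= j < k) la j <= s ^+ C.+1 * (1 / 2) ^+ k.
  rewrite big_split/= prodr_const_nat subn0 -(big_morph _ (exprD s) (expr0 s)).
  rewrite -big_distrr/= big_split/=.
  apply: (@le_trans _ _ ((64 / s ^+ 2) ^+ k * s ^+ (k + C.+1))).
    rewrite ler_wpM2l ?exprn_ge0 ?divr_ge0//; first lra.
    rewrite ler_weXn2l//.
    have h (b : nat -> bool) : (8 * \sum_(0 <= j < k.+1) b j <= k.+1 + C ->
       8 * \sum_(0 <= j < k) b j.+1 <= k.+1 + C)%N.
      move=> hb; apply: leq_trans hb; rewrite big_nat_recl// leq_mul2l/=.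
      exact: leq_addl.
    by have := h _ (bt k.+1); have := h _ (bt' k.+1); lia.
  rewrite exprD mulrA -exprMn mulrC ler_wpM2l ?exprn_ge0//; first lra.
  have h : 64 / s ^+ 2 * s <= 1 / 2.
    rewrite (_ : _ * s = 64 / s); last by field; rewrite gt_eqF//; lra.
    by rewrite ler_pdivrMr; lra.
  have h0 : 0 <= 64 / s ^+ 2 * s by rewrite mulr_ge0 ?divr_ge0//; lra.
  by rewrite lerXn2r// nnegrE; lra.
apply: le_trans (_ : \sum_(0 <= k < n) s ^+ C.+1 * (1 / 2) ^+ k <= _).
  exact: ler_sum.
rewrite -mulr_sumr mulrC ler_wpM2r ?exprn_ge0//; first lra.
have -> : \sum_(0 <= k < n) (1 / 2 : R) ^+ k = 2 - 2 * (1 / 2) ^+ n.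
  elim: (n) => [|m ih]; first by rewrite big_geq// expr0; ring.
  by rewrite big_nat_recr//= ih exprS; field.
by rewrite gerBl mulr_ge0// exprn_ge0.
Qed.

End backward_orbit.

(** * The upper bounding graph *)

Section upper_graph_infimum.
Context {R : realType} (rho kappa : R).
Hypothesis kappa_ge1 : 1 <= kappa.

Let kappa_ge0 : 0 <= kappa. Proof. exact: le_trans kappa_ge1. Qed.
Let psi := bounding_line rho kappa.
Let phi := upper_graph rho kappa.

(** The fibres of the images of the cylinder are the segments from 0 to the
    bounding lines, so that the upper bounding graph is their infimum; this is
    the content of [upper_graph_le] and [upper_graph_ge]. *)
Lemma iter_skew_cylinder n (t x : R) :
  (iter n (skew rho kappa) @` cylinder) (t, x) <->
  circle t /\ 0 <= x <= psi n t.
Proof.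
elim: n t x => [|n ih] t x.
  split=> [[[u y] [/= cu]]|[ct x01]].
    by rewrite in_itv/= => y01 [<- <-].
  by exists (t, x) => //; split=> //=; rewrite in_itv.
have psiS : psi n.+1 t =
  tanh (kappa * psi n (frac (t - rho))) * sin (pi * frac (t - rho)) by [].
split.
  case=> p pc; rewrite iterS /skew; set q := iter n _ p => -[q1 q2].
  have /ih[cq /andP[sq0 sq1]] : (iter n (skew rho kappa) @` cylinder) (q.1, q.2).
    by exists p => //; rewrite -surjective_pairing.
  have e : q.1 = frac (t - rho) by exact: frac_inj.
  have s0 := sin_pi_circle_ge0 (t - rho).
  split; first by rewrite -q1; exact: frac_circle.
  rewrite -q2 psiS -e mulr_ge0 ?tanh_ge0 ?mulr_ge0//=; last by rewrite e.
  by rewrite ler_wpM2r ?e// tanh_le// ler_wpM2l// -e.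
case=> ct /andP[x0]; rewrite psiS; set b := frac (t - rho) => xb.
have /andP[p0 p1] : 0 <= psi n b <= 1 by exact: bounding_line_itv.
have cf : continuous (fun y => tanh (kappa * y) * sin (pi * b)).
  move=> y; apply: cvgM; last exact: cvg_cst.
  by apply: continuous_comp; [exact: mulrl_continuous|exact: continuous_tanh].
have [||y] := @IVT R (fun y => tanh (kappa * y) * sin (pi * b)) 0 (psi n b) x p0.
- exact: continuous_subspaceT.
- by rewrite mulr0 tanh0 mul0r ge_min x0/= le_max xb orbT.
rewrite in_itv/= => yb yx.
have /ih[p pc pe] : circle b /\ 0 <= y <= psi n b by split=> //; exact: frac_circle.
by exists p => //; rewrite /= pe /skew/= fracK// yx.
Qed.

Let fibre t : set R := [set x | x \in `[0, 1] /\ attractor rho kappa (t, x)].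

Lemma upper_graph_le n t : circle t -> phi t <= psi n t.
Proof.
move=> ct; apply: ge_sup; last first.
  by move=> x [_ /(_ n I)/iter_skew_cylinder[_ /andP[]]].
exists 0; split; first by rewrite in_itv/= lexx ler01.
move=> m _; apply/iter_skew_cylinder; split=> //; rewrite lexx.
by have /andP[] := bounding_line_itv rho kappa_ge1 m t.
Qed.

Lemma upper_graph_ge a t : circle t -> 0 <= a -> (forall n, a <= psi n t) ->
  a <= phi t.
Proof.
move=> ct a0 h; apply: ub_le_sup.
  by exists 1 => x [/[!in_itv]/andP[]].
split; first by rewrite in_itv/= a0 (h 0%N).
by move=> n _; apply/iter_skew_cylinder; rewrite a0 h.
Qed.

Lemma upper_graph_lip_of_lines t t' (e : R) : circle t -> circle t' ->
  (forall n, `|psi n t - psi n t'| <= e) -> `|phi t - phi t'| <= e.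
Proof.
move=> ct ct' h.
(* It suffices to bound each graph by the other one plus [e]; when [phi v - e] is
   negative, nonnegativity of [phi u] suffices. *)
suff w u v : circle u -> circle v -> (forall n, `|psi n u - psi n v| <= e) ->
    phi v - e <= phi u.
  have := w _ _ ct ct' h.
  have := w _ _ ct' ct (fun n => _).
  rewrite ler_distl => h1 h2; rewrite h2/= -lerBlDr h1// => n.
  by rewrite distrC.
move=> cu cv {}h; have [v0|v0] := leP 0 (phi v - e).
  apply: upper_graph_ge => // n.
  have := upper_graph_le n cv; have := h n; rewrite ler_norml => /andP[]; lra.
apply: le_trans (ltW v0) _; apply: upper_graph_ge => // n.
by have /andP[] := bounding_line_itv rho kappa_ge1 n u.
Qed.

End upper_graph_infimum.

(** * Lipschitz continuity on slowly recurrent points *)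

(** The angles whose backward orbit approaches 0 at most exponentially fast,
    with constant controlled by [M]. *)
Definition slow_recurrence (R : realType) (rho : R) (M : nat) : set R :=
  [set t | circle t /\ forall j, (2 ^+ j * M.+1%:R)^-1 <= zero_dist rho t j].

Section lipschitz.
Context {R : realType} (c d rho : R).
Hypotheses (c_gt0 : 0 < c) (d_ge0 : 0 <= d) (dioph : diophantine c d rho).

Let beta := `|ln (c / 2)|.

Lemma zero_dist_gt0 M t j : slow_recurrence rho M t -> 0 < zero_dist rho t j.
Proof.
move=> [_ /(_ j)]; apply: lt_le_trans.
by rewrite invr_gt0 mulr_gt0 ?exprn_gt0.
Qed.

(** This is where the Diophantine condition enters: two times at which the
    backward orbit is close to 0 must be far apart, as their difference nearly
    returns 0 to itself. *)
Lemma zero_dist_sep t j k : (j < k)%N ->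
  0 < zero_dist rho t j -> 0 < zero_dist rho t k ->
  Num.min (- ln (zero_dist rho t j)) (- ln (zero_dist rho t k)) <=
    beta + d * ln (k - j)%:R.
Proof.
move=> jk; set x := zero_dist rho t j; set y := zero_dist rho t k => x0 y0.
have kj : (0 < k - j)%N by rewrite subn_gt0.
have h : c * (k - j)%:R `^ (- d) <= x + y.
  apply: le_trans (dioph kj) _.
  apply: le_trans (dist_intB _ _).
  by rewrite natrB ?(ltnW jk)// -!natr1 le_eqVlt; apply/orP; left; apply/eqP;
    congr dist_int; ring.
set z := c / 2 * (k - j)%:R `^ (- d).
have z0 : 0 < z by rewrite mulr_gt0 ?divr_gt0// powR_gt0 ?ltr0n.
have lz : - ln z <= beta + d * ln (k - j)%:R.
  rewrite lnM ?posrE ?divr_gt0 ?powR_gt0 ?ltr0n// ln_powR mulNr opprD opprK.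
  by rewrite lerD2r /beta -normrN ler_norm.
apply: le_trans lz.
have [xz|xz] := leP z x.
  by rewrite ge_min lerN2 ler_ln ?posrE ?xz.
have yz : z <= y by rewrite /z in xz *; lra.
by rewrite ge_min !lerN2 [X in _ || X]ler_ln ?posrE// yz orbT.
Qed.

Lemma upper_graph_lip M kappa :
  expR (128 * (2 * d + beta + 1)) <= kappa ->
  exists2 L, 0 < L & forall t t', slow_recurrence rho M t ->
    slow_recurrence rho M t' ->
    `|upper_graph rho kappa t - upper_graph rho kappa t'| <= L * `|t - t'|.
Proof.
move=> hk; have b0 : 0 <= beta by exact: normr_ge0.
have d0 := d_ge0.
have k0 : 0 < kappa by apply: lt_le_trans hk; exact: expR_gt0.
have lk : 128 * (2 * d + beta + 1) <= ln kappa.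
  by rewrite -ler_expR lnK ?posrE.
(* exp 128 = (exp 32) ^ 4 >= 33 ^ 4 > 128 ^ 2. *)
have k128 : 128 ^+ 2 <= kappa.
  apply: le_trans hk; apply: (@le_trans _ _ (expR 128)); last first.
    by rewrite ler_expR ler_peMr//; lra.
  have -> : (128 : R) = 4 * 32 by ring.
  rewrite expRM_natl; apply: (@le_trans _ _ (33 ^+ 4)).
    by rewrite -!natrM -!natrX ler_nat.
  rewrite lerXn2r ?nnegrE ?expR_ge0//.
  by have := expR_ge1Dx (32 : R); lra.
set s := Num.sqrt kappa.
have ks : kappa = s ^+ 2 by rewrite sqr_sqrtr// ltW.
have s128 : 128 <= s.
  by rewrite -(@ler_sqr R) ?nnegrE ?sqrtr_ge0// -ks.
have k1 : 1 <= kappa by rewrite ks exprn_ege1//; lra.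
have bad t : slow_recurrence rho M t -> forall k,
    (8 * \sum_(0 <= j < k) bad_time rho kappa s t j <= k + M.+1)%N.
  move=> tM k; have q0 j := zero_dist_gt0 j tM.
  apply: (@bad_density R (fun j => - ln (zero_dist rho t j)) d beta _ _ _ _ _ _
    (ln kappa / 4)) => //.
  - by move=> j; rewrite oppr_ge0 ln_le0// dist_int_le1.
  - by move=> i j ij; exact: zero_dist_sep.
  - move=> j; have [_ /(_ j)] := tM.
    have p0 : 0 < 2 ^+ j * M.+1%:R :> R by rewrite mulr_gt0 ?exprn_gt0.
    move=> h; have {h} : ln (2 ^+ j * M.+1%:R)^-1 <= ln (zero_dist rho t j).
      by rewrite ler_ln ?posrE ?invr_gt0.
    rewrite lnV ?posrE// lnM ?posrE ?exprn_gt0// lnXn// lerNl => /le_trans; apply.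
    have l2 : ln 2 <= 1 :> R.
      by have := @le_ln1Dx R 1; rewrite (_ : 1 + 1 = 2)//; apply.
    rewrite lerD//; last by rewrite ltW// ln_sublinear.
    by rewrite -[_ *+ j]mulr_natl ler_piMr.
  - by move=> i bi; apply: (@bad_time_window _ _ _ _ s) => //; lra.
  - lra.
exists (2 * pi * s ^+ M.+2).
  have s0 : 0 < s by lra.
  by apply: mulr_gt0; [apply: mulr_gt0 => //; exact: pi_gt0|exact: exprn_gt0].
move=> t t' tM tM'; apply: upper_graph_lip_of_lines => //.
- by case: tM.
- by case: tM'.
move=> n.
have pre0 u : circle u -> preimage_angle rho u 0 = u.
  move=> /circleE u01; rewrite /preimage_angle mul0r subr0 /frac.
  by rewrite (@floor_def _ _ 0) ?subr0.
have := bounding_line_lip k1 n s128 ks (bad t tM) (bad t' tM').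
by rewrite !pre0//; [case: tM'|case: tM].
Qed.

End lipschitz.

(** * The limit of a quotient of logarithms *)

Lemma cvg_div_ln_right0 (R : realType) (C : R) : C / ln e @[e --> 0^'+] --> 0.
Proof.
rewrite -[X in _ --> X](mulr0 C); apply: cvgMr.
apply/(@ltr0_cvgV0 _ _ _ _ (@ln R)); last exact: lnNy.
near=> e; apply: ln_lt0; apply/andP; split.
  by near: e; exact: nbhs_right_gt.
by near: e; apply: nbhs_right_lt.
Unshelve. all: by end_near. Qed.

Lemma cvg_lne_div_ln (R : realType) (m : R -> \bar R) (K L : R) :
  0 < K -> 0 < L ->
  (\forall e \near 0^'+, ((e / L)%:E <= m e <= (K * e)%:E)%E) ->
  (lne (m e) / (ln e)%:E)%E @[e --> 0^'+] --> 1%E.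
Proof.
move=> K0 L0 h.
apply: (@squeeze_cvge _ _ _ _ (fun e => (1 + ln K / ln e)%:E) _
  (fun e => (1 + (- ln L) / ln e)%:E)).
- near=> e.
  have e0 : 0 < e by near: e; exact: nbhs_right_gt.
  have e1 : e < 1 by near: e; apply: nbhs_right_lt.
  have l0 : ln e < 0 by rewrite ln_lt0// e0.
  have : ((e / L)%:E <= m e <= (K * e)%:E)%E by near: e.
  case: (m e) => [r| |]; last 2 first.
  - by rewrite leye_eq andbF.
  - by rewrite leeNy_eq.
  rewrite !lee_fin => /andP[h1 h2].
  have r0 : 0 < r by apply: lt_le_trans h1; rewrite divr_gt0.
  rewrite lne_EFin// inver lt_eqF// -EFinM !lee_fin.
  have l1 : ln e - ln L <= ln r by rewrite -ln_div ?posrE// ler_ln ?posrE// divr_gt0.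
  have l2 : ln r <= ln K + ln e by rewrite -lnM ?posrE// ler_ln ?posrE// mulr_gt0.
  have -> : 1 + ln K / ln e = (ln K + ln e) / ln e by field; rewrite lt_eqF.
  have -> : 1 + - ln L / ln e = (ln e - ln L) / ln e by field; rewrite lt_eqF.
  by rewrite !ler_nM2r ?invr_lt0// l1 l2.
- apply: cvg_EFin; first by near=> e.
  by rewrite -[X in _ --> X]addr0; apply: cvgD; [exact: cvg_cst|exact: cvg_div_ln_right0].
- apply: cvg_EFin; first by near=> e.
  by rewrite -[X in _ --> X]addr0; apply: cvgD; [exact: cvg_cst|exact: cvg_div_ln_right0].
Unshelve. all: by end_near. Qed.

(** * Almost every point is slowly recurrent *)

Lemma open_dist_int_lt (R : realType) (x e : R) :
  open [set t | dist_int (t - x) < e].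
Proof.
rewrite (_ : [set t | _] = \bigcup_(k in [set: int]) ball (x + k%:~R) e).
  by apply: bigcup_open => k _; exact: ball_open.
apply/seteqP; split=> t /=.
  move=> /dist_int_lt[k hk]; exists k => //.
  by rewrite /ball/= /ball_/= distrC opprD addrA.
move=> [k _]; rewrite /ball/= /ball_/= distrC opprD addrA => hk.
exact: le_lt_trans (dist_int_le _ _) hk.
Qed.

(** Within [[0, 1[] the condition describes at most three intervals of length
    [2 * e], around the representatives of [x] in [[-1, 2[]. *)
Lemma lebesgue_dist_int_lt (R : realType) (x e : R) : 0 <= e -> e <= 1 ->
  (lebesgue_measure (@circle R `&` [set t | (dist_int (t - x) < e)%R]) <= (6 * e)%:E)%E.
Proof.
move=> e0 e1; have /andP[x0 x1] := frac_itv x.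
have b k : measurable (ball (frac x + k%:~R : R) e) by exact: measurable_ball.
apply: (@le_trans _ _ (lebesgue_measure (ball (frac x + (-1)%:~R) e `|`
  ball (frac x + 0%:~R) e `|` ball (frac x + 1%:~R) e))).
  apply: le_measure; rewrite ?inE.
  - apply: measurableI; first exact: measurable_itv.
    by apply: open_measurable; exact: open_dist_int_lt.
  - by apply: measurableU; [apply: measurableU|]; exact: measurable_ball.
  - move=> t /= [/circleE/andP[t0 t1]].
    have {1}-> : x = frac x + (Num.floor x)%:~R by rewrite subrK.
    move=> /dist_int_lt[k hk].
    have {}hk : `|t - frac x - (Num.floor x + k)%:~R| < e.
      by move: hk; rewrite intrD; congr (`|_| < _); ring.
    move: hk; set l := Num.floor x + k => hl.
    have hb : ball (frac x + l%:~R) e t.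
      by rewrite /ball/= /ball_/= distrC opprD addrA.
    have : `|l%:~R : R| < 2.
      move: hl; rewrite !ltr_norml => /andP[l1 l2].
      apply/andP; split; lra.
    rewrite -intr_norm (_ : 2 = 2%:~R)// ltr_int => l2.
    have : l = -1 \/ l = 0 \/ l = 1 by lia.
    by case=> [le|[le|le]]; rewrite le in hb; [left; left|left; right|right].
have hU2 (A B : set R) : measurable A -> measurable B ->
  (lebesgue_measure (A `|` B) <= lebesgue_measure A + lebesgue_measure B)%E.
  by move=> mA mB; exact: measureU2.
apply: le_trans (hU2 _ _ _ _) _ => //; first exact: measurableU.
rewrite [X in (_ + X)%E]lebesgue_measure_ball//.
apply: (@le_trans _ _ ((e *+ 2 + e *+ 2)%:E + (e *+ 2)%:E)%E).
  rewrite leeD2r//; apply: le_trans (hU2 _ _ _ _) _ => //.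
  by rewrite !lebesgue_measure_ball.
rewrite -EFinD lee_fin; lra.
Qed.

Section slow_recurrence_measure.
Context {R : realType} (rho : R).

Lemma measurable_slow_recurrence M : measurable (slow_recurrence rho M).
Proof.
rewrite (_ : slow_recurrence rho M = @circle R `\` \bigcup_j
    [set t | dist_int (t - j.+1%:R * rho) < (2 ^+ j * M.+1%:R)^-1]).
  apply: measurableD; first exact: measurable_itv.
  apply: bigcup_measurable => j _; apply: open_measurable.
  exact: open_dist_int_lt.
apply/seteqP; split=> t.
  by move=> [ct h]; split=> // -[j _ /=]; rewrite ltNge h.
move=> [ct h]; split=> // j; rewrite leNgt; apply/negP => hj.
by apply: h; exists j.
Qed.

Lemma lebesgue_not_slow_recurrence M :
  (lebesgue_measure (@circle R `\` slow_recurrence rho M) <= (12 / M.+1%:R)%:E)%E.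
Proof.
have M0 : 0 < M.+1%:R :> R by [].
pose F j : set R := circle `&`
  [set t | dist_int (t - j.+1%:R * rho) < (2 ^+ j * M.+1%:R)^-1].
apply: (@le_trans _ _ (\sum_(0 <= j <oo) lebesgue_measure (F j))%E).
  apply: measure_sigma_subadditive.
  - move=> j; apply: measurableI; first exact: measurable_itv.
    by apply: open_measurable; exact: open_dist_int_lt.
  - apply: measurableD; first exact: measurable_itv.
    exact: measurable_slow_recurrence.
  - move=> t [ct nt]; apply: contrapT => h; apply: nt; split=> // j.
    by rewrite leNgt; apply/negP => hj; apply: h; exists j.
(* 6 / (2 ^ j * (M + 1)) is 12 / (M + 1) divided by 2 ^ (j + 1). *)
apply: le_trans
  (_ : \sum_(0 <= j <oo) ((12 / M.+1%:R) / (2 ^ j.+1)%:R)%:E <= _)%E.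
  apply: lee_nneseries => [j _ _|j _]; first exact: measure_ge0.
  have p0 : 0 < 2 ^+ j * M.+1%:R :> R by rewrite mulr_gt0 ?exprn_gt0.
  apply: le_trans (lebesgue_dist_int_lt _ _ _) _.
  - by rewrite invr_ge0 ltW.
  - rewrite invf_le1// -natrX -natrM ler1n muln_gt0 expn_gt0//.
  - rewrite lee_fin natrX exprS le_eqVlt; apply/orP; left; apply/eqP; field.
    by rewrite !gt_eqF ?exprn_gt0.
by apply: (epsilon_trick0 xpredT); rewrite divr_ge0.
Qed.

Lemma ae_slow_recurrence : lebesgue_measure.-negligible
  (@circle R `\` \bigcup_M slow_recurrence rho M).
Proof.
have mN : measurable (@circle R `\` \bigcup_M slow_recurrence rho M).
  apply: measurableD; first exact: measurable_itv.
  by apply: bigcup_measurable => M _; exact: measurable_slow_recurrence.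
apply/negligibleP => //; apply/eqP; rewrite eq_le measure_ge0 andbT.
apply/lee_addgt0Pr => e e0; rewrite add0e.
have [M hM] : exists M : nat, 12 / e < M.+1%:R.
  exists (Num.truncn (12 / e)).
  by have := truncnS_gt (12 / e).
apply: (@le_trans _ _ (12 / M.+1%:R)%:E); last first.
  by rewrite lee_fin ler_pdivrMr// mulrC -ler_pdivrMr// ltW.
apply: le_trans (lebesgue_not_slow_recurrence M).
apply: le_measure; rewrite ?inE//.
  apply: measurableD; first exact: measurable_itv.
  exact: measurable_slow_recurrence.
by apply: setDS => t; exact: bigcup_sup.
Qed.

End slow_recurrence_measure.

(** * Balls and null sets for the graph measure *)

Section graph_measure.
Context {R : realType} (rho kappa : R).
Hypothesis kappa_ge1 : 1 <= kappa.

Let phi := upper_graph rho kappa.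

Lemma mu_graph_lebesgue (A : set (R * R)) : mu_graph rho kappa A =
  lebesgue_measure (circle `&` (fun t => (t, phi t)) @^-1` A).
Proof.
congr lebesgue_measure; apply/seteqP; split=> t /=.
  by move=> [p [Ap [s cs sp]] <-]; rewrite -sp in Ap *; split.
by move=> [ct At]; exists (t, phi t) => //; split=> //; exists t.
Qed.

Lemma upper_graph_itv t : circle t -> 0 <= phi t <= 1.
Proof.
move=> ct; apply/andP; split; last exact: (@upper_graph_le _ rho _ kappa_ge1 0 _ ct).
apply: upper_graph_ge => // n.
by have /andP[] := bounding_line_itv rho kappa_ge1 n t.
Qed.

(** Small balls around interior points of [[0, 1[] do not wrap around. *)
Lemma circle_dist_lt (s t e : R) : 0 < s < 1 -> 0 <= t < 1 -> e <= s ->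
  e <= 1 - s -> (circle_dist s t < e) = (`|s - t| < e).
Proof.
move=> /andP[s0 s1] /andP[t0 t1] es es1; apply/idP/idP; last first.
  by apply: le_lt_trans; exact: dist_int_norm.
move=> /dist_int_lt[k]; have [->|/eqP k0] := eqVneq k 0; first by rewrite subr0.
have [k1|k1] : k <= -1 \/ 1 <= k by lia.
- have : k%:~R <= -1 :> R by rewrite (_ : -1 = (-1)%:~R)// ler_int.
  by rewrite !ltr_norml => h /andP[]; lra.
- have : 1 <= k%:~R :> R by rewrite (_ : 1 = 1%:~R)// ler_int.
  by rewrite !ltr_norml => h /andP[]; lra.
Qed.

Lemma mu_graph_ball (t e : R) : 0 < t < 1 -> e <= t -> e <= 1 - t ->
  mu_graph rho kappa (cyl_ball (t, phi t) e) =
  lebesgue_measure (circle `&` ball t e `&` [set u | `|phi t - phi u| < e]).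
Proof.
move=> t01 et et1; rewrite mu_graph_lebesgue; congr lebesgue_measure.
apply/seteqP; split=> u /=.
  move=> [cu [_ h1 h2]]; split=> //; split=> //.
  by move: h1; rewrite circle_dist_lt//; exact/circleE.
move=> [[cu h1] h2]; split=> //; split=> //=.
- by split=> //=; rewrite in_itv/=; exact: upper_graph_itv.
- by rewrite circle_dist_lt//; exact/circleE.
Qed.

Lemma measurable_upper_graph_near (x e : R) :
  measurable [set u | `|x - phi u| < e].
Proof.
have -> : [set u | `|x - phi u| < e] = phi @^-1` (ball x e) by [].
rewrite -[X in measurable X]setTI; apply: measurable_upper_graph => //.
exact: measurable_ball.
Qed.

(** At a density point [t] of a set [E] on which the graph is [L]-Lipschitz, the
    part of [E] within distance [e / (L + 1)] of [t] lies under the ball of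
    radius [e], and its Lebesgue measure is at least [e / (L + 1)] for small
    [e]. *)
Lemma pointwise_dim_density (E : set R) (L t : R) : measurable E ->
  E `<=` circle -> 0 < L -> (forall u v, E u -> E v ->
    `|phi u - phi v| <= L * `|u - v|) ->
  E t -> 0 < t ->
  (lebesgue_measure (E `&` ball t r) / lebesgue_measure (ball t r))%E
    @[r --> 0^'+] --> 1%E ->
  pointwise_dim (mu_graph rho kappa) (t, phi t) 1%E.
Proof.
move=> mE Ec L0 lipE Et t0 dens.
have /circleE/andP[_ t1] := Ec _ Et.
have L1 : 0 < L + 1 by lra.
apply: (@cvg_lne_div_ln _ _ 2 (L + 1)) => //.
have [del /= del0 hdel] : exists2 del : R, 0 < del & forall r, 0 < r -> r < del ->
   (r%:E <= lebesgue_measure (E `&` ball t r))%E.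
  have : \forall r \near 0^'+, ((1 / 2)%:E <
      lebesgue_measure (E `&` ball t r) / lebesgue_measure (ball t r))%E.
    apply: (dens [set y | ((1 / 2)%:E < y)%E]); apply: open_nbhs_nbhs.
    by split; [exact: open_ereal_gt_ereal|rewrite /= lte_fin; lra].
  move=> -[del /= del0 h]; exists del => // r r0 rd.
  have := h r; rewrite /= sub0r normrN gtr0_norm// => /(_ rd r0).
  rewrite lebesgue_measure_ball ?(ltW r0)// inver.
  have r20 : 0 < r *+ 2 by rewrite mulrn_wgt0.
  rewrite gt_eqF// lte_pdivlMr// -EFinM (_ : 1 / 2 * _ = r); first exact: ltW.
  by field.
near=> e.
have e0 : 0 < e by near: e; exact: nbhs_right_gt.
have et : e <= t by near: e; exact: nbhs_right_le.
have et1 : e <= 1 - t by near: e; apply: nbhs_right_le; lra.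
have ed : e < del * (L + 1).
  by near: e; apply: nbhs_right_lt; rewrite mulr_gt0.
have mB : measurable (circle `&` ball t e `&` [set u | `|phi t - phi u| < e]).
  apply: measurableI; last exact: measurable_upper_graph_near.
  by apply: measurableI; [exact: measurable_itv|exact: measurable_ball].
rewrite mu_graph_ball ?t0//; apply/andP; split.
  have r0 : 0 < e / (L + 1) by rewrite divr_gt0.
  apply: le_trans (hdel _ r0 _) _; first by rewrite ltr_pdivrMr.
  apply: le_measure; rewrite ?inE//.
    by apply: measurableI => //; exact: measurable_ball.
  move=> u /= [Eu]; rewrite /ball/= /ball_/= ltr_pdivlMr// => tu.
  have n0 : 0 <= `|t - u| by [].
  split; first split; first exact: Ec.
    by apply: le_lt_trans tu; rewrite mulrDr mulr1 lerDr mulr_ge0// ltW.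
  apply: le_lt_trans (lipE _ _ Et Eu) _.
  apply: le_lt_trans tu; rewrite mulrDr mulr1 mulrC lerDl//.
apply: (@le_trans _ _ (lebesgue_measure (ball t e))).
  apply: le_measure; rewrite ?inE//; first exact: measurable_ball.
  by move=> u [[]].
by rewrite lebesgue_measure_ball ?(ltW e0)// mulr_natl.
Unshelve. all: by end_near. Qed.

End graph_measure.

(** Null sets of angles lift to null sets of the graph measure, since the graph
    itself has full measure. *)
Lemma ae_mu_graph (R : realType) (rho kappa : R) (P : R * R -> Prop) :
  lebesgue_measure.-negligible
    (@circle R `&` [set t | ~ P (t, upper_graph rho kappa t)]) ->
  {ae mu_graph rho kappa, forall p, cylinder p -> P p}.
Proof.
move=> [N [mN N0 hN]].
set phi := upper_graph rho kappa.
have mphi : measurable_fun [set: R * R] (fun p : R * R => phi p.1).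
  by apply: measurableT_comp measurable_fst; exact: measurable_upper_graph.
have mB : measurable ([set p : R * R | p.2 != phi p.1] `|` fst @^-1` N).
  apply: measurableU.
    rewrite (_ : [set p | _] = ~` ((fun p => p.2 == phi p.1) @^-1` [set true])).
      apply: measurableC; rewrite -[X in measurable X]setTI.
      by apply: measurable_fun_eqr => //; exact: measurable_snd.
    by apply/seteqP; split=> p /=; [move/negP|move/negP].
  by rewrite -[X in measurable X]setTI; exact: measurable_fst.
exists ([set p : R * R | p.2 != phi p.1] `|` fst @^-1` N); split=> //.
  rewrite mu_graph_lebesgue; apply/eqP; rewrite eq_le measure_ge0 andbT -N0.
  rewrite (_ : _ `&` _ = circle `&` N); last first.
    by apply/seteqP; split=> t /= [ct]; [case=> [|?]; [rewrite eqxx|]|split=> //; right].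
  by apply: le_measure; rewrite ?inE//; apply: measurableI => //; exact: measurable_itv.
move=> p /= hp; have [e|e] := eqVneq p.2 (phi p.1); last by left.
right; apply: hN; split.
  by apply: contrapT => h; apply: hp => -[].
by move=> h; apply: hp => _; rewrite [p]surjective_pairing e.
Qed.

Theorem theorem1p3 (R : realType) (c d : R) (c_gt0 : 0 < c) (d_gt1 : 1 < d) :
  exists kappa0 : R, 0 < kappa0 /\
    forall rho : R, irrational rho -> diophantine c d rho ->
    forall kappa : R, kappa0 <= kappa ->
      {ae mu_graph rho kappa, forall p : R * R,
        cylinder p -> pointwise_dim (mu_graph rho kappa) p 1%E} /\
      exact_dimensional (mu_graph rho kappa).
Proof.
have d0 : 0 <= d by lra.
(* With A = 2 * d + `|ln (c / 2)|, this makes ln kappa / 4 >= 32 * (A + 1), the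
   threshold of [bad_density]. *)
exists (expR (128 * (2 * d + `|ln (c / 2)| + 1))); split; first exact: expR_gt0.
move=> rho _ dioph kappa hk.
have k1 : 1 <= kappa.
  apply: le_trans hk; rewrite -[leLHS]expR0 ler_expR mulr_ge0//.
  by rewrite !addr_ge0// mulr_ge0.
suff ae1 : {ae mu_graph rho kappa, forall p : R * R,
    cylinder p -> pointwise_dim (mu_graph rho kappa) p 1%E}.
  by split=> //; exists 1.
apply: ae_mu_graph.
pose Z M := ~` [set t : R | (lebesgue_measure (slow_recurrence rho M `&` ball t r) /
   lebesgue_measure (ball t r))%E @[r --> 0^'+] --> (\1_(slow_recurrence rho M) t : R)%:E].
have Zneg M : lebesgue_measure.-negligible (Z M).
  by apply: lebesgue_density; exact: measurable_slow_recurrence.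
have Nneg : lebesgue_measure.-negligible
    ((@circle R `\` \bigcup_M slow_recurrence rho M) `|` (\bigcup_M Z M) `|` [set 0]).
  apply: negligibleU; last by apply/negligibleP => //; exact: lebesgue_measure_set1.
  by apply: negligibleU; [exact: ae_slow_recurrence|exact: negligible_bigcup].
apply: negligibleS Nneg.
move=> t [ct nt].
have [t0|t0] := eqVneq t 0; [by right|left].
apply: contrapT => h; apply: nt.
have [M _ tM] : (\bigcup_M slow_recurrence rho M) t.
  by apply: contrapT => h'; apply: h; left; split.
have [L L0 lipL] := upper_graph_lip c_gt0 d0 dioph M hk.
apply: (pointwise_dim_density k1 (@measurable_slow_recurrence _ rho M) _ L0 lipL tM).
- by move=> u [].
- by have /circleE/andP[h0 _] := ct; rewrite lt_neqAle eq_sym t0.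
- have : ~ Z M t by move=> zt; apply: h; right; exists M.
  by move=> /contrapT; rewrite /= indicE mem_set.
Qed.
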